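(* Let $b_1,b_2:\mathbb{R}\to\mathbb{R}$ be smooth functions for which there are constants $\underline\beta,\overline\beta$ such that, for $i=1,2$ and all $s\in\mathbb{R}$, $0<\underline\beta\le b_i'(s)\le\overline\beta<\infty$ and $b_i(-s)=-b_i(s)$. For $i=1,2$ let $\hat h_i:[0,\infty)\to[0,\infty)$ be the inverse of the strictly increasing function $[0,\infty)\to[0,\infty)$, $t\mapsto w_{*,i}(t)=\int_0^t b_i(s)\,ds$. Let $n>0$ be a constant real exponent. Then for any $(h_1,h_2)\in\mathbb{R}^2\setminus\{(0,0)\}$ the equation $$\left|\frac{h_1}{\hat h_1(w_* )}\right|^{n}+\left|\frac{h_2}{\hat h_2(w_* )}\right|^{n}=1$$ has a unique solution $w_*=w_*(h_1,h_2)>0$. Moreover, $w_*(h_1,h_2)\to 0$ as $(h_1,h_2)\to 0$, and $w_*(h_1,h_2)\to\infty$ as $|(h_1,h_2)|\to\infty$. The function $w_*:\mathbb{R}^2\setminus\{(0,0)\}\to\mathbb{R}_+$, $(h_1,h_2)\mapsto w_*(h_1,h_2)$, is continuous, coercive, and symmetric in both arguments, and it can be extended continuously to $\mathbb{R}^2$ by setting $w_*(0,0)=0$.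
   Context: The functions $b_i$ represent scalar B--H curves (magnetic flux as a function of magnetic field) along the two principal axes, and $w_{*,i}$ are the corresponding coenergies along these axes. ''Smooth'' means infinitely differentiable. $|(h_1,h_2)|$ denotes the Euclidean norm. ''Coercive'' means that $w_*(h_1,h_2)\to\infty$ as $|(h_1,h_2)|\to\infty$. ''Symmetric in both arguments'' means even in each argument: $w_*(-h_1,h_2)=w_*(h_1,h_2)=w_*(h_1,-h_2)$. *)

(* Defs.v *)
From HB Require Import structures.
From mathcomp Require Export all_boot all_order all_algebra.
From mathcomp Require Export all_classical all_reals all_analysis.
Export Order.TTheory GRing.Theory Num.Theory.
Export numFieldNormedType.Exports.

Set Implicit Arguments.
Unset Strict Implicit.
Unset Printing Implicit Defensive.

#[global] Open Scope classical_set_scope.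
#[global] Open Scope ring_scope.

Definition smooth (R : realType) (b : R -> R) : Prop :=
  forall (k : nat) (s : R), derivable (b^`(k))%classic s 1.

(* Meaningful only for t >= 0: for t < 0 the interval `[0, t] is empty, so the
   value is 0 instead of the oriented integral. *)
Definition coenergy (R : realType) (b : R -> R) (t : R) : R :=
  \int[lebesgue_measure]_(s in `[0, t]) b s.

(* The inverse of [coenergy b] on the half-line [0, +oo[.  Off the image of the
   half-line it takes the default value 0. *)
Definition inv_coenergy (R : realType) (b : R -> R) : R -> R :=
  'pinv_(fun=> 0) `[0, +oo[ (coenergy b).

(* Real powers are [powR], for which 0 `^ n = 0 whenever n != 0. *)
Definition solves (R : realType) (b1 b2 : R -> R) (n : R) (h : R * R) (w : R) :
    Prop :=
  0 < w /\
  `|h.1 / inv_coenergy b1 w| `^ n + `|h.2 / inv_coenergy b2 w| `^ n = 1.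

(* The library norm on a product is the maximum norm, hence this definition. *)
Definition euclid_norm (R : realType) (h : R * R) : R :=
  Num.sqrt (h.1 ^+ 2 + h.2 ^+ 2).

(* The filter "|h| tends to infinity". *)
Definition euclid_infty (R : realType) : set_system (R * R) :=
  filter_from setT (fun r : R => [set h | r < euclid_norm h]).
Arguments euclid_infty : clear implicits.

Definition coercive (R : realType) (w : R * R -> R) : Prop :=
  w h @[h --> euclid_infty R] --> +oo.

(* Main.v *)
Require Import Defs.
From mathcomp Require Import lra.

Set Implicit Arguments.
Unset Strict Implicit.
Unset Printing Implicit Defensive.

(** The coenergy of a B-H curve is an increasing bijection of [0, +oo[ onto
    itself: by the fundamental theorem of calculus its derivative is b, and
    oddness with the lower slope bound gives b s >= beta * s for s >= 0
    ([coenergy_increasing_onto]).  Hence so are the inverses f1, f2 that occur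
    in the equation ([inverse_increasing_onto]).

    Let [gauge f1 f2 n h w] be the left-hand side of the equation.  For h <> 0
    it is strictly decreasing and continuous in w > 0, at least 1 for some w and
    at most 1 for all large w; so it takes the value 1 exactly once
    ([gauge_eq1_exists], [gauge_decreasing]).

    Continuity of the solution W comes from monotonicity in w and continuity in
    h alone.  By monotonicity, for w > 0, W h < w iff gauge h w < 1, and w < W h
    iff gauge h w > 1 ([gauge_lt1], [gauge_gt1]).  With W 0 = 0 both
    equivalences also hold at h = 0, where the gauge is 0.  Since the gauge is
    continuous in h on the whole plane, the sublevel and superlevel sets of W at
    positive levels are open, which yields the continuity of the extended
    function ([level_extension_continuous]); continuity off the origin and the
    limit at the origin are restrictions of this.  Coercivity follows from the
    same equivalence: if |h| > f1 w + f2 w, then one of the two summands of the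
    gauge exceeds 1, so W h > w ([level_coercive]). *)

(** * Increasing bijections of the half-line *)

(** Values at negative arguments are left free: those of coenergies and of their
    inverses are mere defaults. *)
Definition increasing_onto (R : realType) (f : R -> R) : Prop :=
  [/\ forall x, 0 <= x -> 0 <= f x,
      forall x y, 0 <= x -> 0 <= y -> (f x <= f y) = (x <= y)
    & forall y, 0 <= y -> exists2 x, 0 <= x & f x = y].

Lemma increasing_onto_gt0 (R : realType) (f : R -> R) (x : R) :
  increasing_onto f -> 0 < x -> 0 < f x.
Proof.
move=> [f_ge0 f_mono _] x_gt0; apply: (le_lt_trans (f_ge0 0 (lexx 0))).
by rewrite ltNge f_mono ?(ltW x_gt0)// -ltNge.
Qed.

(** A monotone function without gaps in its range has no jumps. *)
Lemma increasing_onto_continuous (R : realType) (f : R -> R) (a b : R) :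
  increasing_onto f -> 0 <= a -> a <= b -> {within `[a, b], continuous f}.
Proof.
move=> [f_ge0 f_mono f_onto] a_ge0 ab.
apply: segment_inc_surj_continuous => [x y|y] /=; rewrite !in_itv /=.
  move=> /andP[ax _] /andP[ay _].
  by rewrite f_mono ?(le_trans a_ge0 ax) ?(le_trans a_ge0 ay).
move=> /andP[fay yfb].
have [x x_ge0 fx] := f_onto y (le_trans (f_ge0 a a_ge0) fay).
exists x => //=; move: fay yfb; rewrite -fx in_itv/= f_mono// => ax.
by rewrite f_mono ?(le_trans a_ge0 ab)// ax.
Qed.

Lemma inverse_increasing_onto (R : realType) (f : R -> R) :
  increasing_onto f ->
  increasing_onto ('pinv_(fun=> 0) `[0, +oo[ f).
Proof.
move=> [f_ge0 f_mono f_onto].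
have f_inj : {in (`[0, +oo[%classic : set R) &, injective f}.
  move=> x y /set_mem + /set_mem; rewrite /= !in_itv /= !andbT.
  move=> x_ge0 y_ge0 fxy.
  by apply/eqP; rewrite eq_le -(f_mono x y)// -(f_mono y x)// fxy lexx.
set g := 'pinv_ _ _ _.
have gf x : 0 <= x -> g (f x) = x.
  move=> x_ge0; apply: (pinvKV _ f_inj); apply/mem_set.
  by rewrite /= in_itv/= andbT.
split=> [y y_ge0|y z y_ge0 z_ge0|x x_ge0].
- by have [x x_ge0 <-] := f_onto y y_ge0; rewrite gf.
- have [x x_ge0 <-] := f_onto y y_ge0.
  have [t t_ge0 <-] := f_onto z z_ge0.
  by rewrite !gf// f_mono.
- by exists (f x); [exact: f_ge0|exact: gf].
Qed.

(** * Coenergies *)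

Lemma odd_slope_ge (R : realType) (b : R -> R) (beta : R) :
  (forall s : R, derivable b s 1) -> (forall s, beta <= b^`()%classic s) ->
  (forall s, b (- s) = - b s) -> forall s : R, 0 <= s -> beta * s <= b s.
Proof.
move=> b_der b_slope b_odd s s_ge0.
have b0 : b 0 = 0 by have := b_odd 0; rewrite oppr0; lra.
have [||c _] := @MVT_segment R b b^`()%classic 0 s s_ge0.
- by move=> x _; rewrite derive1E; apply: derivableP.
- exact: derivable_within_continuous.
by rewrite b0 !subr0 => ->; rewrite ler_wpM2r.
Qed.

(** The coenergy W is continuous with W 0 = 0 and W' = b > 0 on ]0, +oo[, hence
    strictly increasing; it is unbounded because b >= beta on [1, +oo[. *)
Lemma coenergy_increasing_onto (R : realType) (b : R -> R) (beta : R) :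
  (forall s : R, derivable b s 1) -> 0 < beta ->
  (forall s, beta <= b^`()%classic s) ->
  (forall s, b (- s) = - b s) -> increasing_onto (coenergy b).
Proof.
move=> b_der beta_gt0 b_slope b_odd.
have b_ge := odd_slope_ge b_der b_slope b_odd.
have b_cont : continuous b.
  by move=> x; apply/differentiable_continuous/derivable1_diffP.
have b_int t : lebesgue_measure.-integrable `[0, t] (EFin \o b).
  apply: continuous_compact_integrable; first exact: segment_compact.
  exact: continuous_subspaceT.
have W0 : coenergy b 0 = 0 by rewrite /coenergy set_itv1 Rintegral_set1.
have W_cont (t : R) : 0 <= t -> {within `[0, t], continuous (coenergy b)}.
  by move=> t_ge0; exact: parameterized_integral_continuous.
have W_der (x : R) : 0 < x -> is_derive x 1 (coenergy b) (b x).
  move=> x_gt0.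
  have xx1 : x < x + 1 by rewrite ltrDl.
  have [dW <-] := continuous_FTC1_closed xx1 (b_int (x + 1)) x_gt0 (b_cont x).
  by rewrite derive1E; exact: derivableP.
have W_mvt x y : 0 <= x -> x < y ->
    exists2 c, x < c & coenergy b y - coenergy b x = b c * (y - x).
  move=> x_ge0 xy; have y_ge0 := le_trans x_ge0 (ltW xy).
  have [||c] := @MVT R (coenergy b) b x y xy.
  - by move=> z; rewrite in_itv/= => /andP[xz _]; apply/W_der/(le_lt_trans x_ge0).
  - apply: continuous_subspaceW (W_cont y y_ge0).
    by apply: subset_itvr; rewrite bnd_simp.
  by rewrite in_itv/= => /andP[xc _] eq; exists c.
have W_lt x y : 0 <= x -> x < y -> coenergy b x < coenergy b y.
  move=> x_ge0 xy; have [c xc eq] := W_mvt x y x_ge0 xy.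
  have c_gt0 := le_lt_trans x_ge0 xc.
  rewrite -subr_gt0 eq mulr_gt0 ?subr_gt0//.
  by rewrite (lt_le_trans _ (b_ge c (ltW c_gt0)))// mulr_gt0.
have W_mono x y : 0 <= x -> 0 <= y ->
    (coenergy b x <= coenergy b y) = (x <= y).
  move=> x_ge0 y_ge0; have [xy|yx|->] := ltgtP x y; last exact: lexx.
    by rewrite ltW ?W_lt.
  by apply/negbTE; rewrite -ltNge W_lt.
split=> [x x_ge0|//|y y_ge0]; first by rewrite -W0 W_mono.
(* By the mean value theorem on [1, t], with slope at least beta there, the
   coenergy at this t has reached y. *)
pose t := 1 + y / beta.
have t_ge1 : 1 <= t by rewrite lerDl divr_ge0// ltW.
have t_ge0 : 0 <= t := le_trans ler01 t_ge1.
have yWt : y <= coenergy b t.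
  have W1_ge0 : 0 <= coenergy b 1 by rewrite -W0 W_mono.
  have [y0|y_neq0] := eqVneq y 0; first by rewrite y0 -W0 W_mono.
  have t1 : 1 < t by rewrite ltrDl divr_gt0// lt_neqAle eq_sym y_neq0.
  have [c c1 eq] := W_mvt 1 t ler01 t1.
  rewrite -[leRHS](subrK (coenergy b 1)) eq ler_wpDr//.
  rewrite /t [1 + _]addrC addrK mulrCA ler_peMr// ler_pdivlMr// mul1r.
  rewrite (le_trans _ (b_ge c (ltW (lt_trans ltr01 c1))))//.
  by rewrite ler_peMr ?ltW.
have [|x] := IVT (v := y) t_ge0 (W_cont t t_ge0).
  by rewrite W0 ge_min le_max y_ge0 yWt orbT.
by rewrite in_itv/= => /andP[x_ge0 _] Wx; exists x.
Qed.

(** * The gauge *)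

(** Off 0 the power is differentiable; at 0 the bound |x| ^ n < e amounts to
    |x| < e ^ (1/n), and this is where n > 0 matters. *)
Lemma powR_norm_continuous (R : realType) (n : R) :
  0 < n -> continuous (fun x : R => `|x| `^ n).
Proof.
move=> n_gt0 x; have [->|x_neq0] := eqVneq x 0.
  rewrite /continuous_at normr0 powR0 ?gt_eqF//; apply/cvgr0Pnorm_lt => e e_gt0.
  near=> y; rewrite ger0_norm ?powR_ge0//.
  have -> : e = (e `^ n^-1) `^ n.
    by rewrite -powRrM mulVf ?gt_eqF// powRr1// ltW.
  rewrite gt0_ltr_powR ?nnegrE ?powR_ge0//.
  near: y; apply: cvgr0_norm_lt; [exact: cvg_id|exact: powR_gt0].
apply: (@continuous_comp _ _ _ (fun y : R => `|y|) (fun y : R => y `^ n)).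
  exact: norm_continuous.
apply/differentiable_continuous/derivable1_diffP.
have nx_gt0 : 0 < `|x| by rewrite normr_gt0.
by have := is_derive1_powR n nx_gt0; move=> /@ex_derive.
Unshelve. all: by end_near. Qed.

Lemma powR_norm_div_le (R : realType) (n x y z : R) :
  0 < n -> 0 < y -> y <= z -> `|x / z| `^ n <= `|x / y| `^ n.
Proof.
move=> n_gt0 y_gt0 yz; apply: ge0_ler_powR; rewrite ?nnegrE ?(ltW n_gt0)//.
rewrite !normrM !normfV (gtr0_norm y_gt0) (@gtr0_norm _ z) ?(lt_le_trans y_gt0)//.
by rewrite ler_wpM2l// lef_pV2 ?posrE ?(lt_le_trans y_gt0).
Qed.

Lemma powR_norm_div_lt (R : realType) (n x y z : R) :
  0 < n -> x != 0 -> 0 < y -> y < z -> `|x / z| `^ n < `|x / y| `^ n.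
Proof.
move=> n_gt0 x_neq0 y_gt0 yz; apply: gt0_ltr_powR; rewrite ?nnegrE//.
rewrite !normrM !normfV (gtr0_norm y_gt0) (@gtr0_norm _ z) ?(lt_trans y_gt0)//.
by rewrite ltr_pM2l ?normr_gt0// ltf_pV2 ?posrE// (lt_trans y_gt0).
Qed.

Definition gauge (R : realType) (f1 f2 : R -> R) (n : R) (h : R * R) (w : R) :
    R :=
  `|h.1 / f1 w| `^ n + `|h.2 / f2 w| `^ n.

Lemma gauge0 (R : realType) (f1 f2 : R -> R) (n w : R) :
  0 < n -> gauge f1 f2 n (0, 0) w = 0.
Proof. by move=> n_gt0; rewrite /gauge /= !mul0r normr0 powR0 ?addr0 ?gt_eqF. Qed.

Lemma gauge_decreasing (R : realType) (f1 f2 : R -> R) (n : R) (h : R * R)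
    (v w : R) :
  increasing_onto f1 -> increasing_onto f2 -> 0 < n -> h != (0, 0) ->
  0 < v -> v < w -> gauge f1 f2 n h w < gauge f1 f2 n h v.
Proof.
move=> f1P f2P n_gt0 h_neq0 v_gt0 vw.
have f1v := increasing_onto_gt0 f1P v_gt0.
have f2v := increasing_onto_gt0 f2P v_gt0.
have f_lt f : increasing_onto f -> f v < f w.
  by move=> [_ f_mono _]; rewrite ltNge f_mono -?ltNge// ltW// (lt_trans v_gt0).
case: h h_neq0 => h1 h2; rewrite -pair_eqE /= negb_and => /orP[] h_neq0.
  by apply: ltr_leD; [apply: powR_norm_div_lt|apply/powR_norm_div_le/ltW];
    rewrite ?f_lt.
by apply: ler_ltD; [apply/powR_norm_div_le/ltW|apply: powR_norm_div_lt];
  rewrite ?f_lt.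
Qed.

Lemma gauge_continuous_h (R : realType) (f1 f2 : R -> R) (n w : R) :
  0 < n -> continuous (fun h : R * R => gauge f1 f2 n h w).
Proof.
move=> n_gt0.
have term (c : R) : continuous (fun x : R => `|x / c| `^ n).
  move=> x; apply: (@continuous_comp _ _ _ (fun x : R => x / c)
    (fun y : R => `|y| `^ n)); last exact: powR_norm_continuous.
  by apply: cvgM; [exact: cvg_id|exact: cvg_cst].
move=> h; apply: cvgD.
  apply: (@continuous_comp _ _ _ fst (fun x : R => `|x / f1 w| `^ n)).
    exact: cvg_fst.
  exact: term.
apply: (@continuous_comp _ _ _ snd (fun x : R => `|x / f2 w| `^ n)).
  exact: cvg_snd.
exact: term.
Qed.

Lemma gauge_continuous_w (R : realType) (f1 f2 : R -> R) (n : R) (h : R * R)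
    (a b : R) :
  increasing_onto f1 -> increasing_onto f2 -> 0 < n -> 0 < a -> a <= b ->
  {within `[a, b], continuous (gauge f1 f2 n h)}.
Proof.
move=> f1P f2P n_gt0 a_gt0 ab.
have term (f : R -> R) (c : R) : increasing_onto f ->
    {within `[a, b], continuous (fun w => `|c / f w| `^ n)}.
  move=> fP; rewrite continuous_subspace_in => w /set_mem /=.
  rewrite in_itv /= => /andP[aw _].
  have f_cont := increasing_onto_continuous fP (ltW a_gt0) ab.
  have fw_neq0 : f w != 0.
    by rewrite gt_eqF// (increasing_onto_gt0 fP)// (lt_le_trans a_gt0).
  apply: (@continuous_comp _ _ _ (fun v : subspace `[a, b] => c / f v)
    (fun x : R => `|x| `^ n)); last exact: powR_norm_continuous.
  apply: cvgM; first exact: cvg_cst.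
  by apply: cvgV => //; exact: f_cont.
move=> w; apply: cvgD; exact: term.
Qed.

(** The intermediate value theorem between a level where the gauge is at least 1
    and a larger one where it is at most 1. *)
Lemma gauge_eq1_exists (R : realType) (f1 f2 : R -> R) (n : R) (h : R * R) :
  increasing_onto f1 -> increasing_onto f2 -> 0 < n -> h != (0, 0) ->
  exists2 w, 0 < w & gauge f1 f2 n h w = 1.
Proof.
move=> f1P f2P n_gt0 h_neq0.
have reach (f : R -> R) (x : R) : increasing_onto f -> x != 0 ->
    exists2 a, 0 < a & `|x / f a| `^ n = 1.
  move=> fP x_neq0; have [f_ge0 f_mono f_onto] := fP.
  have [a a_ge0 fa] := f_onto `|x| (normr_ge0 x).
  have [a0|a_neq0] := eqVneq a 0; last first.
    exists a; first by rewrite lt_neqAle eq_sym a_neq0.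
    by rewrite fa normrM normfV normr_id mulfV ?normr_eq0// powR1.
  have [z z_ge0 fz] := f_onto 0 (lexx 0).
  have : f a <= f z by rewrite f_mono// a0.
  by rewrite fa fz normr_le0 (negPf x_neq0).
(* If h_i <> 0, its summand already equals 1 at the level that the i-th inverse
   coenergy maps to |h_i|. *)
have [a a_gt0 a_ge1] : exists2 a, 0 < a & 1 <= gauge f1 f2 n h a.
  case: h h_neq0 => h1 h2; rewrite -pair_eqE /= negb_and => /orP[] h_neq0.
    have [a a_gt0 ha] := reach f1 h1 f1P h_neq0.
    by exists a => //; rewrite /gauge/= ha lerDl powR_ge0.
  have [a a_gt0 ha] := reach f2 h2 f2P h_neq0.
  by exists a => //; rewrite /gauge/= ha lerDr powR_ge0.
(* Far out each summand is at most 1/2: the level b, where f = |x| / c with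
   c ^ n = 1/2, is far enough. *)
have small (f : R -> R) (x : R) : increasing_onto f ->
    exists2 b, 0 <= b & forall w, 0 < w -> b <= w -> `|x / f w| `^ n <= 2^-1.
  move=> fP; have [f_ge0 f_mono f_onto] := fP.
  pose c := 2^-1 `^ n^-1 : R.
  have c_gt0 : 0 < c by rewrite powR_gt0// invr_gt0.
  have [b b_ge0 fb] := f_onto (`|x| / c) (divr_ge0 (normr_ge0 x) (ltW c_gt0)).
  exists b => // w w_gt0 bw.
  have fw_gt0 := increasing_onto_gt0 fP w_gt0.
  have -> : 2^-1 = c `^ n.
    by rewrite -powRrM mulVf ?gt_eqF// powRr1// invr_ge0.
  apply: ge0_ler_powR; rewrite ?nnegrE ?(ltW n_gt0) ?(ltW c_gt0)//.
  rewrite normrM normfV (gtr0_norm fw_gt0) ler_pdivrMr//.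
  by rewrite mulrC -ler_pdivrMr// -fb f_mono// ltW.
have [b1 b1_ge0 hb1] := small f1 h.1 f1P.
have [b2 b2_ge0 hb2] := small f2 h.2 f2P.
pose b := a + b1 + b2.
have ab : a <= b by rewrite /b; lra.
have b_gt0 : 0 < b := lt_le_trans a_gt0 ab.
have b_le1 : gauge f1 f2 n h b <= 1.
  have t1 : `|h.1 / f1 b| `^ n <= 2^-1 by apply: hb1 => //; rewrite /b; lra.
  have t2 : `|h.2 / f2 b| `^ n <= 2^-1 by apply: hb2 => //; rewrite /b; lra.
  rewrite /gauge; lra.
have [|w] := IVT (v := 1) ab (gauge_continuous_w (h := h) f1P f2P n_gt0 a_gt0 ab).
  by rewrite ge_min le_max b_le1 a_ge1 orbT.
rewrite in_itv /= => /andP[aw _] gw; exists w => //.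
exact: lt_le_trans a_gt0 aw.
Qed.

(** Together with the next lemma, this turns comparisons with the implicitly
    defined level v of h into explicit conditions on h. *)
Lemma gauge_lt1 (R : realType) (f1 f2 : R -> R) (n : R) (h : R * R) (v w : R) :
  increasing_onto f1 -> increasing_onto f2 -> 0 < n ->
  h != (0, 0) -> 0 < v -> 0 < w -> gauge f1 f2 n h v = 1 ->
  (gauge f1 f2 n h w < 1) = (v < w).
Proof.
move=> f1P f2P n_gt0 h_neq0 v_gt0 w_gt0 <-; have [vw|wv|->] := ltgtP v w.
- exact: gauge_decreasing.
- by apply/negbTE; rewrite -leNgt ltW//; exact: gauge_decreasing.
- exact: ltxx.
Qed.

Lemma gauge_gt1 (R : realType) (f1 f2 : R -> R) (n : R) (h : R * R) (v w : R) :
  increasing_onto f1 -> increasing_onto f2 -> 0 < n ->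
  h != (0, 0) -> 0 < v -> 0 < w -> gauge f1 f2 n h v = 1 ->
  (1 < gauge f1 f2 n h w) = (w < v).
Proof.
move=> f1P f2P n_gt0 h_neq0 v_gt0 w_gt0 <-; have [wv|vw|->] := ltgtP w v.
- exact: gauge_decreasing.
- by apply/negbTE; rewrite -leNgt ltW//; exact: gauge_decreasing.
- exact: ltxx.
Qed.

(** * The solution as a function of the field *)

(** The sublevel and superlevel sets of the extended solution at positive levels
    are preimages of open half-lines under the gauge, which is continuous in h.
    A lower bound by a level that is not positive is trivial, the solution being
    nonnegative. *)
Lemma level_extension_continuous (R : realType) (f1 f2 : R -> R) (n : R)
    (wstar : R * R -> R) :
  increasing_onto f1 -> increasing_onto f2 -> 0 < n ->
  (forall h, h != (0, 0) -> 0 < wstar h /\ gauge f1 f2 n h (wstar h) = 1) ->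
  continuous (fun h : R * R => if h == (0, 0) then 0 else wstar h).
Proof.
move=> f1P f2P n_gt0 wstarP.
set W := (X in continuous X).
have W_ge0 h : 0 <= W h.
  by rewrite /W; case: eqVneq => // /wstarP[/ltW].
(* The comparison lemmas extend to h = 0, where the gauge vanishes. *)
have W_lt h w : 0 < w -> (gauge f1 f2 n h w < 1) = (W h < w).
  move=> w_gt0; rewrite /W; case: eqVneq => [->|h_neq0].
    by rewrite gauge0// ltr01 w_gt0.
  by have [v_gt0 hv] := wstarP h h_neq0; exact: gauge_lt1.
have W_gt h w : 0 < w -> (1 < gauge f1 f2 n h w) = (w < W h).
  move=> w_gt0; rewrite /W; case: eqVneq => [->|h_neq0].
    by rewrite gauge0// ltr10 ltNge (ltW w_gt0).
  by have [v_gt0 hv] := wstarP h h_neq0; exact: gauge_gt1.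
move=> h; apply/cvgrPdist_le => e e_gt0.
have up : \forall k \near h, W k < W h + e.
  have We_gt0 : 0 < W h + e by rewrite ltr_wpDl.
  have : gauge f1 f2 n h (W h + e) < 1 by rewrite W_lt// ltrDl.
  move=> /(cvgr_lt _ (gauge_continuous_h (w := W h + e) n_gt0 (x := h))).
  by apply: filterS => k; rewrite W_lt.
have down : \forall k \near h, W h - e <= W k.
  have [We_gt0|We_le0] := ltP 0 (W h - e); last first.
    by near=> k; rewrite (le_trans We_le0).
  have : 1 < gauge f1 f2 n h (W h - e) by rewrite W_gt// gtrBl.
  move=> /(cvgr_gt _ (gauge_continuous_h (w := W h - e) n_gt0 (x := h))).
  by apply: filterS => k; rewrite W_gt// => /ltW.
near=> k.
have k_up : W k < W h + e by near: k.
have k_down : W h - e <= W k by near: k.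
by rewrite ler_distl; apply/andP; split; lra.
Unshelve. all: by end_near. Qed.

Lemma euclid_infty_filter (R : realType) : Filter (euclid_infty R).
Proof.
apply: filter_from_filter; first by exists 0.
move=> r s _ _; exists (Num.max r s) => // h /=.
by rewrite gt_max => /andP[].
Qed.

(** The level of h exceeds A as soon as one summand of the gauge at A exceeds 1. *)
Lemma level_coercive (R : realType) (f1 f2 : R -> R) (n : R)
    (wstar : R * R -> R) :
  increasing_onto f1 -> increasing_onto f2 -> 0 < n ->
  (forall h, h != (0, 0) -> 0 < wstar h /\ gauge f1 f2 n h (wstar h) = 1) ->
  coercive wstar.
Proof.
move=> f1P f2P n_gt0 wstarP.
apply/(@cvgryPgt _ _ _ (euclid_infty_filter R)) => M.
(* The comparison of levels is available at positive values only. *)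
pose A := Num.max M 1.
have A_gt0 : 0 < A by rewrite lt_max ltr01 orbT.
have f1A := increasing_onto_gt0 f1P A_gt0.
have f2A := increasing_onto_gt0 f2P A_gt0.
exists (f1 A + f2 A) => // h /= h_big.
have h_neq0 : h != (0, 0).
  apply/eqP => h0; move: h_big; rewrite h0 /euclid_norm /= expr0n /= addr0.
  by rewrite sqrtr0 ltNge ltW// addr_gt0.
have [w_gt0 gw] := wstarP h h_neq0.
suff A_w : A < wstar h by rewrite (le_lt_trans _ A_w)// le_max lexx.
rewrite -(gauge_gt1 f1P f2P n_gt0 h_neq0 w_gt0 A_gt0 gw).
have term_gt1 (x y : R) : 0 < y -> y < `|x| -> 1 < `|x / y| `^ n.
  move=> y_gt0 yx; have <- : 1 `^ n = 1 :> R by rewrite powR1.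
  apply: gt0_ltr_powR; rewrite ?nnegrE//.
  by rewrite normrM normfV (gtr0_norm y_gt0) ltr_pdivlMr// mul1r.
have [h1_le|/term_gt1 t1] := leP `|h.1| (f1 A); last first.
  by rewrite (lt_le_trans (t1 f1A))// lerDl powR_ge0.
have [h2_le|/term_gt1 t2] := leP `|h.2| (f2 A); last first.
  by rewrite (lt_le_trans (t2 f2A))// lerDr powR_ge0.
(* Components below f1 A and f2 A would force the Euclidean norm below the sum. *)
suff : euclid_norm h <= f1 A + f2 A by rewrite leNgt h_big.
have s_ge0 : 0 <= f1 A + f2 A by rewrite addr_ge0 ?ltW.
rewrite -[leRHS](ger0_norm s_ge0) -sqrtr_sqr ler_wsqrtr//.
rewrite -(real_normK (num_real h.1)) -(real_normK (num_real h.2)).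
have := normr_ge0 h.1; have := normr_ge0 h.2; nra.
Qed.

Theorem lemma1 (R : realType) (b1 b2 : R -> R) (beta_lo beta_hi n : R)
  (smooth_b1 : smooth b1) (smooth_b2 : smooth b2)
  (beta_lo_gt0 : 0 < beta_lo)
  (slope_b1 : forall s : R, beta_lo <= (b1^`())%classic s <= beta_hi)
  (slope_b2 : forall s : R, beta_lo <= (b2^`())%classic s <= beta_hi)
  (odd_b1 : forall s : R, b1 (- s) = - b1 s)
  (odd_b2 : forall s : R, b2 (- s) = - b2 s)
  (n_gt0 : 0 < n) :
  (forall h : R * R, h != (0, 0) -> exists! w : R, solves b1 b2 n h w) /\
  (forall wstar : R * R -> R,
    (forall h : R * R, h != (0, 0) -> solves b1 b2 n h (wstar h)) ->
    [/\ wstar h @[h --> ((0, 0) : R * R)^'] --> (0 : R),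
        {within ~` [set ((0, 0) : R * R)], continuous wstar},
        coercive wstar,
        (forall h1 h2 : R, (h1, h2) != (0, 0) ->
           wstar (- h1, h2) = wstar (h1, h2) /\
           wstar (h1, - h2) = wstar (h1, h2))
      & continuous (fun h : R * R => if h == (0, 0) then 0 else wstar h)]).
Proof.
have inv_onto b : smooth b ->
    (forall s, beta_lo <= (b^`())%classic s <= beta_hi) ->
    (forall s, b (- s) = - b s) -> increasing_onto (inv_coenergy b).
  move=> b_smooth b_slope b_odd; apply: inverse_increasing_onto.
  apply: (coenergy_increasing_onto (beta := beta_lo)) => // s.
    exact: (b_smooth 0).
  by have /andP[] := b_slope s.
have f1P := inv_onto b1 smooth_b1 slope_b1 odd_b1.
have f2P := inv_onto b2 smooth_b2 slope_b2 odd_b2.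
move: f1P f2P; rewrite /solves.
set f1 := inv_coenergy b1; set f2 := inv_coenergy b2 => f1P f2P.
have sol_uniq h v w : h != (0, 0) -> 0 < v -> 0 < w ->
    gauge f1 f2 n h v = 1 -> gauge f1 f2 n h w = 1 -> v = w.
  move=> h_neq0 v_gt0 w_gt0 gv gw; apply/eqP; rewrite eq_le !leNgt.
  by rewrite -(gauge_gt1 f1P f2P n_gt0 h_neq0 v_gt0 w_gt0 gv)
    -(gauge_lt1 f1P f2P n_gt0 h_neq0 v_gt0 w_gt0 gv) gw ltxx.
split=> [h h_neq0|wstar wstarP].
  have [w w_gt0 gw] := gauge_eq1_exists f1P f2P n_gt0 h_neq0.
  by exists w; split=> // v [v_gt0 gv]; exact: (sol_uniq h).
have W_cont := level_extension_continuous f1P f2P n_gt0 wstarP.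
set W := fun h => _ in W_cont.
have W_eq h : h != (0, 0) -> W h = wstar h by rewrite /W => /negPf ->.
split.
- have : W h @[h --> ((0, 0) : R * R)^'] --> (0 : R).
    have := W_cont (0, 0); rewrite /continuous_at {2}/W eqxx.
    by apply: cvg_trans; apply: cvg_app; exact: nbhs_dnbhs.
  apply: cvg_trans; apply: near_eq_cvg.
  by near=> h; apply: W_eq; near: h; exact: nbhs_dnbhs_neq.
- have := continuous_subspaceT W_cont (A := ~` [set ((0, 0) : R * R)]).
  apply: subspace_eq_continuous => h /set_mem /= /eqP h_neq0.
  exact: W_eq.
- exact: (level_coercive f1P f2P n_gt0).
(* The equation involves h only through |h_1| and |h_2|. *)
- move=> h1 h2 h_neq0; have [w_gt0 gw] := wstarP _ h_neq0.
  have sym k1 k2 : `|k1| = `|h1| -> `|k2| = `|h2| ->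
      wstar (k1, k2) = wstar (h1, h2).
    move=> n1 n2.
    have k_neq0 : (k1, k2) != (0, 0).
      move: h_neq0; rewrite -!pair_eqE /=.
      by rewrite -(normr_eq0 h1) -(normr_eq0 h2) -n1 -n2 !normr_eq0.
    have [v_gt0 gv] := wstarP _ k_neq0.
    apply: (sol_uniq (h1, h2)) => //; rewrite -gv /gauge /=.
    by rewrite !normrM n1 n2.
  by rewrite !sym ?normrN.
- exact: W_cont.
Unshelve. all: by end_near. Qed.
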